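(* Let $r\in\{3,5,6,7\}$ and let $t\ge0$ be an integer. Then the pseudo $H$-type Lie algebra $\mathfrak n_{r+8t,0}$ is not isomorphic (as a Lie algebra) to $\mathfrak n_{0,r+8t}$.
   Context: For integers $r,s\ge 0$ with $r+s\ge1$, $\mathbb R^{r,s}$ is $\mathbb R^{r+s}$ with $\langle Z,W\rangle_{r,s}=\sum_{i=1}^r Z_iW_i-\sum_{j=r+1}^{r+s}Z_jW_j$, and $\mathrm{Cl}_{r,s}$ is the real unital associative algebra generated by $\mathbb R^{r,s}$ subject to $Z\otimes Z=-\langle Z,Z\rangle_{r,s}\,1$. A scalar product is a non-degenerate (possibly indefinite) symmetric bilinear form. An admissible $\mathrm{Cl}_{r,s}$-module is a non-zero finite-dimensional real vector space $\mathfrak v$ with a representation $J:\mathrm{Cl}_{r,s}\to\mathrm{End}(\mathfrak v)$ and a scalar product $\langle\cdot,\cdot\rangle_{\mathfrak v}$ such that $\langle J_Zv,w\rangle_{\mathfrak v}=-\langle v,J_Zw\rangle_{\mathfrak v}$ for all $Z\in\mathbb R^{r,s}$, $v,w\in\mathfrak v$. It is minimal if its dimension is minimal among admissible $\mathrm{Cl}_{r,s}$-modules. The associated pseudo $H$-type Lie algebra is $\mathfrak n=\mathfrak v\oplus\mathbb R^{r,s}$ (orthogonal sum), with center $\mathbb R^{r,s}$ and bracket $[\cdot,\cdot]:\mathfrak v\times\mathfrak v\to\mathbb R^{r,s}$ determined by $\langle J_Zv,w\rangle_{\mathfrak v}=\langle Z,[v,w]\rangle_{r,s}$ for all $Z\in\mathbb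 R^{r,s}$, $v,w\in\mathfrak v$. The notation $\mathfrak n_{r,s}=\mathfrak v_{r,s}\oplus\mathfrak z_{r,s}$, $\mathfrak z_{r,s}=\mathbb R^{r,s}$, stands for the pseudo $H$-type Lie algebra built from a minimal admissible module $\mathfrak v_{r,s}$ (for $s=0$ the scalar product on $\mathfrak v_{r,0}$ is positive definite). Isomorphisms are isomorphisms of Lie algebras, with no condition on scalar products. *)

(* Defs.v *)
From HB Require Import structures.
From mathcomp Require Import all_boot all_order all_algebra.
From mathcomp Require Import boolp reals.

Set Implicit Arguments.
Unset Strict Implicit.
Unset Printing Implicit Defensive.

Import Order.TTheory GRing.Theory Num.Theory.
Local Open Scope ring_scope.
Local Open Scope quotient_scope.

Definition rs_sign {R : pzRingType} (r i : nat) : R := if (i < r)%N then 1 else -1.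

Definition rs_form {R : realType} (r s : nat) (Z W : 'rV[R]_(r + s)) : R :=
  \sum_(i < r) Z 0 (lshift s i) * W 0 (lshift s i)
  - \sum_(j < s) Z 0 (rshift r j) * W 0 (rshift r j).

Lemma rs_formE (R : realType) (r s : nat) (Z W : 'rV[R]_(r + s)) :
  rs_form Z W = \sum_(i < r + s) rs_sign r i * (Z 0 i * W 0 i).
Proof.
rewrite big_split_ord /= /rs_form /rs_sign; congr (_ + _).
  by apply: eq_bigr => i _; rewrite /= ltn_ord mul1r.
by rewrite -sumrN; apply: eq_bigr => j _; rewrite /= ltnNge leq_addr mulN1r.
Qed.

(* Cl_{r,s} is presented by generators and relations: algebra expressions in the
   elements of R^{r,s}, modulo the least congruence containing the axioms of real
   unital associative algebras, linearity of the inclusion of R^{r,s}, and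
   Z^2 = - <Z, Z>. Lemma [clifford_universal] below is its universal property. *)

Section CliffordAlgebra.
Variables (R : realType) (r s : nat).

Inductive cl_expr : Type :=
| CGen of 'rV[R]_(r + s)
| CZero
| COne
| CAdd of cl_expr & cl_expr
| CMul of cl_expr & cl_expr
| CScale of R & cl_expr.

Inductive cl_eq : cl_expr -> cl_expr -> Prop :=
| cl_refl x : cl_eq x x
| cl_sym x y of cl_eq x y : cl_eq y x
| cl_trans x y z of cl_eq x y & cl_eq y z : cl_eq x z
| cl_add x x' y y' of cl_eq x x' & cl_eq y y' : cl_eq (CAdd x y) (CAdd x' y')
| cl_mul x x' y y' of cl_eq x x' & cl_eq y y' : cl_eq (CMul x y) (CMul x' y')
| cl_scale a x x' of cl_eq x x' : cl_eq (CScale a x) (CScale a x')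
| cl_addA x y z : cl_eq (CAdd x (CAdd y z)) (CAdd (CAdd x y) z)
| cl_addC x y : cl_eq (CAdd x y) (CAdd y x)
| cl_add0 x : cl_eq (CAdd CZero x) x
| cl_addN x : cl_eq (CAdd (CScale (-1) x) x) CZero
| cl_mulA x y z : cl_eq (CMul x (CMul y z)) (CMul (CMul x y) z)
| cl_mul1x x : cl_eq (CMul COne x) x
| cl_mulx1 x : cl_eq (CMul x COne) x
| cl_mulDl x y z : cl_eq (CMul (CAdd x y) z) (CAdd (CMul x z) (CMul y z))
| cl_mulDr x y z : cl_eq (CMul x (CAdd y z)) (CAdd (CMul x y) (CMul x z))
| cl_scaleA a b x : cl_eq (CScale a (CScale b x)) (CScale (a * b) x)
| cl_scale1 x : cl_eq (CScale 1 x) x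
| cl_scaleDr a x y : cl_eq (CScale a (CAdd x y)) (CAdd (CScale a x) (CScale a y))
| cl_scaleDl a b x : cl_eq (CScale (a + b) x) (CAdd (CScale a x) (CScale b x))
| cl_scaleAl a x y : cl_eq (CScale a (CMul x y)) (CMul (CScale a x) y)
| cl_scaleAr a x y : cl_eq (CScale a (CMul x y)) (CMul x (CScale a y))
| cl_genD Z W : cl_eq (CGen (Z + W)) (CAdd (CGen Z) (CGen W))
| cl_genZ a Z : cl_eq (CGen (a *: Z)) (CScale a (CGen Z))
| cl_gen_sqr Z : cl_eq (CMul (CGen Z) (CGen Z)) (CScale (- rs_form Z Z) COne).

HB.instance Definition _ := gen_eqMixin cl_expr.
HB.instance Definition _ := gen_choiceMixin cl_expr.

Definition cl_eqb (x y : cl_expr) : bool := `[< cl_eq x y >].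

Lemma cl_eqb_refl : reflexive cl_eqb.
Proof. by move=> x; apply/asboolP/cl_refl. Qed.

Lemma cl_eqb_sym : symmetric cl_eqb.
Proof. by move=> x y; apply/asboolP/asboolP; apply: cl_sym. Qed.

Lemma cl_eqb_trans : transitive cl_eqb.
Proof. by move=> y x z /asboolP xy /asboolP yz; apply/asboolP/(cl_trans xy yz). Qed.

Canonical cl_equiv := EquivRel cl_eqb cl_eqb_refl cl_eqb_sym cl_eqb_trans.

Definition clifford := {eq_quot cl_equiv}.

HB.instance Definition _ := Choice.on clifford.

Definition cl_pi (x : cl_expr) : clifford := \pi_({eq_quot cl_equiv}) x.
Definition cl_repr (x : clifford) : cl_expr := repr (x : {eq_quot cl_equiv}).

Lemma cl_piP x y : cl_eq x y <-> cl_pi x = cl_pi y.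
Proof.
split=> [xy|/eqP]; first by apply/eqP; rewrite eqmodE /=; apply/asboolP.
by rewrite eqmodE /= => /asboolP.
Qed.

Lemma cl_reprK x : cl_pi (cl_repr x) = x.
Proof. exact: reprK. Qed.

Lemma cl_repr_pi x : cl_eq (cl_repr (cl_pi x)) x.
Proof. by apply/cl_piP; rewrite cl_reprK. Qed.

Lemma cl_piW (P : clifford -> Prop) : (forall x, P (cl_pi x)) -> forall x, P x.
Proof. by move=> Ppi x; rewrite -(cl_reprK x). Qed.

Let zero : clifford := cl_pi CZero.
Let one : clifford := cl_pi COne.
Let add (x y : clifford) : clifford := cl_pi (CAdd (cl_repr x) (cl_repr y)).
Let mul (x y : clifford) : clifford := cl_pi (CMul (cl_repr x) (cl_repr y)).
Let scale (a : R) (x : clifford) : clifford := cl_pi (CScale a (cl_repr x)).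
Let opp (x : clifford) : clifford := scale (-1) x.

Let piD x y : add (cl_pi x) (cl_pi y) = cl_pi (CAdd x y).
Proof. by apply/cl_piP/cl_add; apply: cl_repr_pi. Qed.
Let piM x y : mul (cl_pi x) (cl_pi y) = cl_pi (CMul x y).
Proof. by apply/cl_piP/cl_mul; apply: cl_repr_pi. Qed.
Let piZ a x : scale a (cl_pi x) = cl_pi (CScale a x).
Proof. by apply/cl_piP/cl_scale/cl_repr_pi. Qed.
Let piE := (piD, piM, piZ).

Let addA : associative add.
Proof.
by elim/cl_piW=> x; elim/cl_piW=> y; elim/cl_piW=> z; rewrite !piE; apply/cl_piP/cl_addA.
Qed.
Let addC : commutative add.
Proof. by elim/cl_piW=> x; elim/cl_piW=> y; rewrite !piE; apply/cl_piP/cl_addC. Qed.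
Let add0 : left_id zero add.
Proof. by elim/cl_piW=> x; rewrite /zero !piE; apply/cl_piP/cl_add0. Qed.
Let addN : left_inverse zero opp add.
Proof. by elim/cl_piW=> x; rewrite /opp /zero !piE; apply/cl_piP/cl_addN. Qed.
Let mulA : associative mul.
Proof.
by elim/cl_piW=> x; elim/cl_piW=> y; elim/cl_piW=> z; rewrite !piE; apply/cl_piP/cl_mulA.
Qed.
Let mul1 : left_id one mul.
Proof. by elim/cl_piW=> x; rewrite /one !piE; apply/cl_piP/cl_mul1x. Qed.
Let mulx1 : right_id one mul.
Proof. by elim/cl_piW=> x; rewrite /one !piE; apply/cl_piP/cl_mulx1. Qed.
Let mulDl : left_distributive mul add.
Proof.
by elim/cl_piW=> x; elim/cl_piW=> y; elim/cl_piW=> z; rewrite !piE; apply/cl_piP/cl_mulDl.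
Qed.
Let mulDr : right_distributive mul add.
Proof.
by elim/cl_piW=> x; elim/cl_piW=> y; elim/cl_piW=> z; rewrite !piE; apply/cl_piP/cl_mulDr.
Qed.

HB.instance Definition _ := GRing.isZmodule.Build clifford addA addC add0 addN.
HB.instance Definition _ :=
  GRing.Zmodule_isPzRing.Build clifford mulA mul1 mulx1 mulDl mulDr.

Let scaleA a b x : scale a (scale b x) = scale (a * b) x.
Proof. by elim/cl_piW: x => x; rewrite !piE; apply/cl_piP/cl_scaleA. Qed.
Let scale1 : left_id 1 scale.
Proof. by elim/cl_piW=> x; rewrite !piE; apply/cl_piP/cl_scale1. Qed.
Let scaleDr : right_distributive scale add.
Proof.
by move=> a; elim/cl_piW=> x; elim/cl_piW=> y; rewrite !piE; apply/cl_piP/cl_scaleDr.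
Qed.
Let scaleDl x : {morph scale^~ x : a b / a + b >-> add a b}.
Proof. by move=> a b; elim/cl_piW: x => x; rewrite /= !piE; apply/cl_piP/cl_scaleDl. Qed.

HB.instance Definition _ :=
  GRing.Zmodule_isLmodule.Build R clifford scaleA scale1 scaleDr scaleDl.

Lemma cl_piD x y : cl_pi (CAdd x y) = cl_pi x + cl_pi y. Proof. exact/esym/piD. Qed.
Lemma cl_piM x y : cl_pi (CMul x y) = cl_pi x * cl_pi y. Proof. exact/esym/piM. Qed.
Lemma cl_piZ a x : cl_pi (CScale a x) = a *: cl_pi x. Proof. exact/esym/piZ. Qed.

Definition cl_gen (Z : 'rV[R]_(r + s)) : clifford := cl_pi (CGen Z).

Fact cl_gen_is_linear : linear cl_gen.
Proof.
move=> a Z W; rewrite /cl_gen -cl_piZ -cl_piD; apply/cl_piP.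
exact: cl_trans (cl_genD _ _) (cl_add (cl_genZ _ _) (cl_refl _)).
Qed.
HB.instance Definition _ := GRing.isLinear.Build R _ _ _ cl_gen cl_gen_is_linear.

Section Eval.
Variables (A : algType R) (phi : {linear 'rV[R]_(r + s) -> A}).
Hypothesis phi_sqr : forall Z, phi Z * phi Z = - rs_form Z Z *: 1.

Fixpoint cl_expr_eval (x : cl_expr) : A :=
  match x with
  | CGen Z => phi Z
  | CZero => 0
  | COne => 1
  | CAdd x y => cl_expr_eval x + cl_expr_eval y
  | CMul x y => cl_expr_eval x * cl_expr_eval y
  | CScale a x => a *: cl_expr_eval x
  end.

Lemma cl_expr_eval_eq x y : cl_eq x y -> cl_expr_eval x = cl_expr_eval y.
Proof.
elim=> /=; try by move=> *; congruence.
all: move=> *; rewrite ?(scaleN1r, addrA, mulrA, mul1r, mulr1, add0r, addNr) //.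
all: rewrite ?(mulrDl, mulrDr, scalerA, scale1r, scalerDr, scalerDl) //.
all: rewrite ?(linearD, linearZ) //.
- exact: addrC.
- exact: scalerAl.
- exact: scalerAr.
Qed.

End Eval.

Lemma rs_form_matrices : exists m (phi : {linear 'rV[R]_(r + s) -> 'M[R]_m.+1}),
  forall Z, phi Z * phi Z = - rs_form Z Z *: 1.
Proof.
have ex n (eps : nat -> R) : exists m (A : (nat -> R) -> 'M[R]_m), [/\ (0 < m)%N,
    forall a u v, A (fun i => a * u i + v i) = a *: A u + A v
    & forall u, A u *m A u = (\sum_(i < n) eps i * (u i * u i))%:M].
  elim: n => [|n [m [A [m_gt0 Alin Asq]]]].
    exists 1, (fun=> 0); split=> // [a u v|u]; first by rewrite scaler0 addr0.
    by rewrite big_ord0 mul0mx raddf0.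
  exists (m + m)%N, (fun u => block_mx (A u) (u n)%:M (eps n * u n)%:M (- A u)).
  split=> [|a u v|u]; first by rewrite addn_gt0 m_gt0.
    rewrite Alin scale_block_mx add_block_mx opprD scalerN !scale_scalar_mx.
    by rewrite -!raddfD /= mulrDr mulrCA.
  rewrite mulmx_block !mul_scalar_mx !mul_mx_scalar mulmxN mulNmx opprK !scalerN.
  rewrite subrr addrN Asq !scale_scalar_mx big_ord_recr /= -!raddfD /=.
  by rewrite mulrCA mulrA [_ * u n + _]addrC -scalar_mx_block.
have [[|m] [A []]] := ex (r + s)%N (fun i => - rs_sign r i); first by [].
move=> _ Alin Asq.
pose co (Z : 'rV[R]_(r + s)) i := oapp (Z 0) 0 (insub i).
have colin : linear (A \o co).
  move=> a Z W /=; rewrite -Alin; congr A; apply/funext => i; rewrite /co.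
  by case: insubP => /= [j _ _|_]; rewrite ?mxE ?mulr0 ?addr0.
pose phiM := GRing.isLinear.Build R _ _ _ (A \o co) colin.
pose phi : {linear 'rV[R]_(r + s) -> 'M[R]_m.+1} := HB.pack (A \o co) phiM.
exists m, phi => Z; rewrite [LHS]Asq -scalemx1 rs_formE -sumrN.
by congr (_ *: _); apply: eq_bigr => i _; rewrite mulNr /co valK.
Qed.

Fact cl_one_neq0 : 1 != 0 :> clifford.
Proof.
have [m [phi phiP]] := rs_form_matrices.
apply/eqP => /cl_piP /(cl_expr_eval_eq phiP) /= /eqP.
by rewrite oner_eq0.
Qed.

HB.instance Definition _ := GRing.PzSemiRing_isNonZero.Build clifford cl_one_neq0.

Fact cl_scalerAl (a : R) (x y : clifford) : a *: (x * y) = (a *: x) * y.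
Proof.
elim/cl_piW: x => x; elim/cl_piW: y => y.
by rewrite -cl_piM -!cl_piZ -cl_piM; apply/cl_piP/cl_scaleAl.
Qed.
HB.instance Definition _ :=
  GRing.LSemiModule_isLSemiAlgebra.Build R clifford cl_scalerAl.

Fact cl_scalerAr (a : R) (x y : clifford) : a *: (x * y) = x * (a *: y).
Proof.
elim/cl_piW: x => x; elim/cl_piW: y => y.
by rewrite -cl_piM -!cl_piZ -cl_piM; apply/cl_piP/cl_scaleAr.
Qed.
HB.instance Definition _ :=
  GRing.LSemiAlgebra_isSemiAlgebra.Build R clifford cl_scalerAr.

Lemma cl_gen_sqrE Z : cl_gen Z * cl_gen Z = (- rs_form Z Z)%:A.
Proof. by rewrite /cl_gen -cl_piM -[1]/(cl_pi COne) -cl_piZ; apply/cl_piP/cl_gen_sqr. Qed.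


Lemma clifford_universal (A : algType R) (phi : {linear 'rV[R]_(r + s) -> A}) :
    (forall Z, phi Z * phi Z = (- rs_form Z Z)%:A) ->
  exists2 f : {lrmorphism clifford -> A},
    forall Z, f (cl_gen Z) = phi Z
    & forall g : {lrmorphism clifford -> A},
        (forall Z, g (cl_gen Z) = phi Z) -> g =1 f.
Proof.
move=> phi_sqr; pose f (x : clifford) := cl_expr_eval phi (cl_repr x).
have f_pi x : f (cl_pi x) = cl_expr_eval phi x.
  exact/(cl_expr_eval_eq phi_sqr)/cl_repr_pi.
have flin : linear f.
  move=> a; elim/cl_piW=> x; elim/cl_piW=> y.
  by rewrite -cl_piZ -cl_piD !f_pi.
have fmul : monoid_morphism f.
  split=> [|x y]; first by rewrite -[1]/(cl_pi COne) f_pi.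
  by elim/cl_piW: x => x; elim/cl_piW: y => y; rewrite -cl_piM !f_pi.
pose fL := GRing.isLinear.Build R _ _ _ f flin.
pose fM := GRing.isMonoidMorphism.Build _ _ f fmul.
pose F : {lrmorphism clifford -> A} := HB.pack f fL fM.
exists F => [Z|g gphi x]; first exact: f_pi.
elim/cl_piW: x => x; rewrite /= f_pi.
elim: x => [Z|||x IHx y IHy|x IHx y IHy|a x IHx] /=.
- exact: gphi.
- exact: rmorph0.
- exact: rmorph1.
- by rewrite cl_piD rmorphD; congr (_ + _); [exact: IHx|exact: IHy].
- by rewrite cl_piM rmorphM; congr (_ * _); [exact: IHx|exact: IHy].
- by rewrite cl_piZ linearZ_LR; congr (_ *: _); exact: IHx.
Qed.

End CliffordAlgebra.

Arguments cl_gen {R r s} Z.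

(* [comp_lfun] is used instead of a product on 'End(V) because MathComp equips
   'End(V) with a ring structure only when V is known to be nonzero. *)
Record clifford_rep (R : realType) (r s : nat) (V : vectType R) := CliffordRep {
  cl_rep_fun :> {linear clifford R r s -> 'End(V)};
  cl_rep1 : cl_rep_fun 1 = \1%VF;
  cl_repM : forall x y, cl_rep_fun (x * y) = (cl_rep_fun x \o cl_rep_fun y)%VF
}.

Record admissible_module (R : realType) (r s : nat) := AdmissibleModule {
  am_space : vectType R;
  am_rep : clifford_rep r s am_space;
  am_form : {symmetric am_space};
  am_neq0 : (0 < \dim {: am_space})%N;
  am_nondegenerate : nondegenerate am_form;
  am_skew : forall (Z : 'rV[R]_(r + s)) (v w : am_space),
    am_form (am_rep (cl_gen Z) v) w = - am_form v (am_rep (cl_gen Z) w)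
}.

Definition am_J (R : realType) (r s : nat) (M : admissible_module R r s)
  (Z : 'rV[R]_(r + s)) : 'End(am_space M) := am_rep M (cl_gen Z).

Definition minimal_admissible (R : realType) (r s : nat)
    (M : admissible_module R r s) : Prop :=
  forall N : admissible_module R r s,
    (\dim {: am_space M} <= \dim {: am_space N})%N.

Definition positive_definite_module (R : realType) (r s : nat)
    (M : admissible_module R r s) : Prop :=
  forall v : am_space M, v != 0 -> 0 < am_form M v v.

HB.mixin Record Lmodule_isLieAlgebra (R : pzRingType) L of GRing.Lmodule R L := {
  lie_bracket : L -> L -> L;
  lie_bracket_linearl : forall y, linear (lie_bracket^~ y);
  lie_bracket_linearr : forall x, linear (lie_bracket x);
  lie_bracketxx : forall x, lie_bracket x x = 0;
  lie_jacobi : forall x y z,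
    lie_bracket x (lie_bracket y z) + lie_bracket y (lie_bracket z x)
    + lie_bracket z (lie_bracket x y) = 0
}.

#[short(type="lieAlgType")]
HB.structure Definition LieAlgebra (R : pzRingType) :=
  {L of GRing.Lmodule R L & Lmodule_isLieAlgebra R L}.

Definition lie_isomorphic (R : pzRingType) (g h : lieAlgType R) : Prop :=
  exists2 f : {linear g -> h},
    bijective f & {morph f : x y / lie_bracket x y >-> lie_bracket x y}.

Section PseudoHType.
Variables (R : realType) (r s : nat) (M : admissible_module R r s).

Local Notation V := (am_space M).

(* Coordinates of [v, w] in the orthonormal basis e_i of R^{r,s}, where
   <e_i, e_i> = rs_sign r i. *)
Definition ph_center_bracket (v w : V) : 'rV[R]_(r + s) :=
  \row_i (rs_sign r i * am_form M (am_J M (delta_mx 0 i) v) w).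

Lemma am_formC (v w : V) : am_form M v w = am_form M w v.
Proof. by rewrite hermC /= expr0 mul1r. Qed.

Lemma am_J_skew Z (v w : V) : am_form M (am_J M Z v) w = - am_form M v (am_J M Z w).
Proof. exact: am_skew. Qed.

Lemma ph_center_bracketE Z (v w : V) :
  am_form M (am_J M Z v) w = rs_form Z (ph_center_bracket v w).
Proof.
rewrite rs_formE {1}[Z]row_sum_delta /am_J !linear_sum sum_lfunE linear_sumlz /=.
apply: eq_bigr => i _; rewrite mxE !linearZ /= lfunE /= linearZl_LR /=.
rewrite mulrCA; congr (_ * _); rewrite mulrA.
by rewrite /rs_sign; case: ifP => _; rewrite ?mulrNN !mul1r.
Qed.

Lemma ph_center_bracketP (b : V -> V -> 'rV[R]_(r + s)) :
  (forall Z v w, am_form M (am_J M Z v) w = rs_form Z (b v w)) <->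
  b = ph_center_bracket.
Proof.
split=> [bP|-> Z v w]; last exact: ph_center_bracketE.
apply/funext=> v; apply/funext=> w; apply/rowP=> i; rewrite mxE bP rs_formE.
rewrite (bigD1 i) //= big1 => [|j ji]; last by rewrite mxE (negbTE ji) andbF mul0r mulr0.
rewrite mxE !eqxx mul1r addr0 mulrA.
by rewrite /rs_sign; case: ifP => _; rewrite ?mulrNN !mul1r.
Qed.

Definition pseudo_H : Type := (V * 'rV[R]_(r + s))%type.

HB.instance Definition _ := Vector.on pseudo_H.

Definition ph_bracket (x y : pseudo_H) : pseudo_H := (0, ph_center_bracket x.1 y.1).

Fact ph_bracket_linearl y : linear (ph_bracket^~ y).
Proof.
move=> a x x'; congr pair; first by rewrite /= scaler0 addr0.
apply/rowP=> i; rewrite !mxE /=.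
by rewrite linearP linearPl mulrDr mulrCA.
Qed.

Fact ph_bracket_linearr x : linear (ph_bracket x).
Proof.
move=> a y y'; congr pair; first by rewrite /= scaler0 addr0.
apply/rowP=> i; rewrite !mxE /=.
by rewrite linearPr mulrDr mulrCA.
Qed.

Fact ph_bracketxx x : ph_bracket x x = 0.
Proof.
congr pair; apply/rowP=> i; rewrite !mxE.
suff -> : am_form M (am_J M (delta_mx 0 i) x.1) x.1 = 0 by rewrite mulr0.
by apply/eqP; rewrite -eqNr eq_sym {1}am_formC am_J_skew opprK.
Qed.

Fact ph_jacobi x y z :
  ph_bracket x (ph_bracket y z) + ph_bracket y (ph_bracket z x)
  + ph_bracket z (ph_bracket x y) = 0.
Proof.
have b0 u v w : ph_bracket u (ph_bracket v w) = 0.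
  by congr pair; apply/rowP=> i; rewrite !mxE linear0r mulr0.
by rewrite !b0 !addr0.
Qed.

HB.instance Definition _ := Lmodule_isLieAlgebra.Build R pseudo_H
  ph_bracket_linearl ph_bracket_linearr ph_bracketxx ph_jacobi.

End PseudoHType.

(* Main.v *)
Require Import Defs.
From HB Require Import structures.
From mathcomp Require Import all_boot all_order all_algebra.
From mathcomp Require Import complex reals ring.
From mathcomp Require spectral.
Set Implicit Arguments.
Unset Strict Implicit.
Unset Printing Implicit Defensive.
Import Order.TTheory GRing.Theory Num.Theory VectorInternalTheory.

(** Isomorphic Lie algebras have the same dimension, so with k = r + 8t it is
    enough to produce an admissible Cl_{k,0}-module of dimension strictly less
    than dim N ([smaller_admissible_module]); the minimality of M then gives
    dim M < dim N.

    Let J_1, ..., J_k be the operators of N. They anticommute, have square 1,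
    and are skew for the form G of N. Averaging over the finite group that they
    generate gives a positive definite form B for which they are orthogonal,
    hence symmetric ([invariant_posdefmx]). Write G(v, w) = B(Tv, w). Then T is
    invertible, B-symmetric and anticommutes with every J_i. It has a real
    eigenvalue l, which is nonzero, and on the kernel of T^2 - l^2 the operator
    S = T / l is an involution anticommuting with every J_i. There the operators
    K_i = J_i S anticommute and have square -1. So a nonzero space of dimension
    at most dim N is a Cl_{k,0}-module and carries, in addition, an involution S
    anticommuting with all the K_i.

    The arithmetic of k enters only through [reducible_mod8]: if k is 3, 5, 6 or
    7 modulo 8, a Cl_{k,0}-module with such an S is never irreducible. This
    reflects the fact that the irreducible modules of Cl_{k,1}, with one
    additional generator of square +1, have twice the dimension of those of
    Cl_{k,0}. A proper nonzero submodule, equipped with an averaged positive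
    definite form, is the required admissible module ([half_module],
    [admissible_of_gen_mx]).

    Reducibility is propagated through two operations on the signature (p, q),
    the numbers of generators of square -1 and of square +1. Multiplying four
    generators of square -1 by their product turns them into generators of
    square +1 of the same algebra ([reducible_swap]). For e, f anticommuting of
    squares -1 and +1, the product e f is an involution commuting with all the
    other generators; its fixed space is a module for them of half the
    dimension, whose submodules induce submodules of the whole
    ([reducible_drop]). Together they give (p + 8, q) -> (p + 4, q + 4) ->
    (p, q), which removes t, and they bring (5, 0), (6, 0), (7, 0) down to
    (0, 3), (0, 2), (0, 1). These three and (3, 0) are done by hand. *)

Local Open Scope ring_scope.

(** * Commutation up to sign *)

Section SignCommutation.
Variable T : pzRingType.
Implicit Types (e : bool) (x y z : T).

(** The sign is a boolean so that signs of products add up by [addb], and a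
    commutation between explicit monomials is decided by computation. *)
Definition sgncomm e x y := x * y == (-1) ^+ e * (y * x).
Notation anti := (sgncomm true).

Lemma sgncomm_sym e : symmetric (sgncomm e).
Proof.
by move=> x y; apply/eqP/eqP => ->; rewrite mulrA -expr2 sqrr_sign mul1r.
Qed.

Lemma anti_sym x y : anti x y -> anti y x.
Proof. by rewrite sgncomm_sym. Qed.

Lemma sgncommxx x : sgncomm false x x.
Proof. by rewrite /sgncomm mul1r. Qed.

Lemma sgncommM e e' x y z :
  sgncomm e x y -> sgncomm e' x z -> sgncomm (e (+) e') x (y * z).
Proof.
move=> /eqP xy /eqP xz; apply/eqP; rewrite signr_addb mulrA xy -!mulrA xz.
by congr (_ * _); rewrite !mulrA; congr (_ * _ * _); apply: commr_sign.
Qed.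

Lemma sgncommMl e e' x y z :
  sgncomm e y x -> sgncomm e' z x -> sgncomm (e (+) e') (y * z) x.
Proof. by rewrite !(sgncomm_sym _ _ x); apply: sgncommM. Qed.

Lemma sgncommM4 e1 e2 e3 e4 x a b c d :
  sgncomm e1 x a -> sgncomm e2 x b -> sgncomm e3 x c -> sgncomm e4 x d ->
  sgncomm (e1 (+) e2 (+) (e3 (+) e4)) x (a * b * (c * d)).
Proof. by move=> xa xb xc xd; do 2 ?apply: sgncommM. Qed.

Lemma antiE x y : anti x y -> x * y = - (y * x).
Proof. by move/eqP->; rewrite mulN1r. Qed.

Lemma commE x y : sgncomm false x y -> x * y = y * x.
Proof. by move/eqP->; rewrite mul1r. Qed.

Lemma sqrM_anti x y : anti x y -> (x * y) * (x * y) = - ((x * x) * (y * y)).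
Proof.
move=> /antiE xy; rewrite -!mulrA (mulrA y x y).
have -> : y * x = - (x * y) by rewrite xy opprK.
by rewrite mulNr mulrN -!mulrA.
Qed.

Lemma sqrM_comm x y :
  sgncomm false x y -> (x * y) * (x * y) = (x * x) * (y * y).
Proof. by move=> /commE xy; rewrite -!mulrA (mulrA y x y) -xy -!mulrA. Qed.

End SignCommutation.

Notation anti := (sgncomm true).

(** * Halving a space along an involution *)

Section Halving.
Variables (R : realFieldType) (n : nat).
Implicit Types (E F W f g h x y : 'M[R]_n).

Lemma stablemx_mul E f g : stablemx E f -> stablemx E g -> stablemx E (f * g).
Proof. exact: stablemxM. Qed.

Lemma stablemx_cap E F f :
  stablemx E f -> stablemx F f -> stablemx (E :&: F)%MS f.
Proof.
move=> Ef Ff; rewrite sub_capmx.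
rewrite (submx_trans (submxMr _ (capmxSl _ _))) //.
exact: submx_trans (submxMr _ (capmxSr _ _)) Ff.
Qed.

Definition pos_part E h := (E :&: eigenspace h 1)%MS.

Lemma pos_part_mul m (W : 'M_(m, n)) E h : (W <= pos_part E h)%MS -> W *m h = W.
Proof. by rewrite sub_capmx => /andP[_ /eigenspaceP]; rewrite scale1r. Qed.

Lemma pos_part_stable E h f :
  sgncomm false f h -> stablemx E f -> stablemx (pos_part E h) f.
Proof.
move=> /commE fh Ef; apply: stablemx_cap => //.
exact/comm_mx_stable_eigenspace/esym.
Qed.

Variables (E h g : 'M[R]_n) (e : bool).
Hypotheses (h2 : h * h = 1) (g2 : g * g = (-1) ^+ e) (gh : anti g h).
Hypotheses (Eh : stablemx E h) (Eg : stablemx E g) (E0 : E != 0).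

Let mulKg m (W : 'M_(m, n)) : W *m g *m g = (-1) ^+ e *: W.
Proof.
rewrite -mulmxA [g *m g]g2; case: (e); last by rewrite !expr0 scale1r mulmx1.
by rewrite !expr1 scaleN1r mulmxN mulmx1.
Qed.

Let rank_mulg m (W : 'M_(m, n)) : \rank (W *m g) = \rank W.
Proof.
apply/eqP; rewrite eqn_leq mxrankM_maxl /=.
rewrite -[X in (X <= _)%N](eqmx_scale W (negbT (signr_eq0 R e))) -mulKg.
exact: mxrankM_maxl.
Qed.

Let hg m (W : 'M_(m, n)) : (W <= pos_part E h)%MS -> W *m g *m h = - (W *m g).
Proof.
move=> /pos_part_mul Wh.
by rewrite -mulmxA [g *m h](antiE gh) mulmxN mulmxA Wh.
Qed.

(** An involution without fixed vector on E acts there as -1; but g exchanges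
    its two eigenspaces. *)
Lemma pos_part_neq0 : pos_part E h != 0.
Proof.
apply: contraNneq E0 => P0.
have P0' m (v : 'M_(m, n)) : (v <= E)%MS -> v *m h = v -> v = 0.
  move=> vE vh; apply/eqP; rewrite -submx0 -P0 sub_capmx vE.
  by apply/eigenspaceP; rewrite scale1r.
have EhN : E *m h = - E.
  apply/eqP; rewrite -addr_eq0; apply/eqP/P0'.
    by rewrite addmx_sub.
  by rewrite mulmxDl -mulmxA [h *m h]h2 mulmx1 addrC.
suff : E *m g = 0 by rewrite -mxrank_eq0 -rank_mulg => ->; rewrite mxrank0.
apply: P0' => //.
by rewrite -mulmxA [g *m h](antiE gh) mulmxN mulmxA EhN mulNmx opprK.
Qed.

(** W and W g lie in the eigenspaces of h for 1 and -1, so their sum is direct. *)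
Let sub_g m (W : 'M_(m, n)) : (W <= pos_part E h)%MS ->
  \rank (W + W *m g)%MS = (2 * \rank W)%N.
Proof.
move=> WP; rewrite mxrank_disjoint_sum ?rank_mulg ?mul2n ?addnn //.
apply/eqP; rewrite -submx0; set C := (_ :&: _)%MS.
have Ch : C *m h = C := pos_part_mul (submx_trans (capmxSl _ _) WP).
have /submxP[D CD] : (C <= W *m g)%MS by apply: capmxSr.
have : C *m h = - C by rewrite CD -mulmxA hg // mulmxN.
rewrite Ch => /eqP; rewrite -addr_eq0 -mulr2n -scaler_nat scaler_eq0.
rewrite pnatr_eq0 /=.
by move=> /eqP->; rewrite submx_refl.
Qed.

Lemma pos_part_rank : (2 * \rank (pos_part E h) <= \rank E)%N.
Proof.
rewrite -sub_g ?submx_refl //; apply: mxrankS.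
by rewrite addsmx_sub capmxSl (submx_trans (submxMr _ (capmxSl _ _))).
Qed.

Lemma pos_part_rank_lt : (\rank (pos_part E h) < \rank E)%N.
Proof.
apply: leq_trans pos_part_rank; rewrite ltn_Pmull // lt0n mxrank_eq0.
exact: pos_part_neq0.
Qed.

(** A subspace F of the fixed space of h in E induces F + F g, a subspace of E,
    proper when F is proper in that fixed space; an operator that preserves F and
    commutes with g up to a sign preserves it too. *)
Variables (m : nat) (F : 'M[R]_(m, n)).
Hypotheses (FP : (F <= pos_part E h)%MS) (F0 : F != 0).

Lemma lift_neq0 : (F + F *m g)%MS != 0.
Proof. by rewrite -mxrank_eq0 sub_g // muln_eq0 /= mxrank_eq0. Qed.

Lemma lift_rank :
  (\rank F < \rank (pos_part E h))%N -> (\rank (F + F *m g)%MS < \rank E)%N.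
Proof.
move=> rF; rewrite sub_g //; apply: leq_trans pos_part_rank.
by rewrite ltn_pmul2l.
Qed.

Lemma lift_sub : (F + F *m g <= E)%MS.
Proof.
have FE : (F <= E)%MS := submx_trans FP (capmxSl _ _).
by rewrite addsmx_sub FE (submx_trans (submxMr _ FE)).
Qed.

Lemma lift_stable f b :
  sgncomm b f g -> stablemx F f -> stablemx (F + F *m g)%MS f.
Proof.
move=> fg Ff; rewrite addsmxMr addsmxS //.
have -> : F *m g *m f = (-1) ^+ b *: (F *m f *m g).
  rewrite -!mulmxA; case: b fg => [/antiE fg|/commE fg].
    by rewrite [f *m g]fg mulmxN expr1 scaleN1r opprK.
  by rewrite [f *m g]fg expr0 scale1r.
by rewrite scalemx_sub // submxMr.
Qed.

Lemma lift_stable_g : stablemx (F + F *m g)%MS g.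
Proof. by rewrite addsmxMr mulKg addsmxC addsmxS // scalemx_sub. Qed.

Lemma lift_stable_h : stablemx (F + F *m g)%MS h.
Proof. by rewrite addsmxMr (pos_part_mul FP) hg // addsmxS // eqmx_opp. Qed.

End Halving.

(** * Clifford systems with an additional involution *)

Section CliffordSystems.
Variable R : realFieldType.

Definition clifford_system n (K F : seq 'M[R]_n) :=
  [&& all (fun x => x * x == -1) K, all (fun x => x * x == 1) F
    & pairwise anti (F ++ K)].

(** The common carrier E is a subspace of a fixed ambient space, in which the
    relations hold globally: passing to a smaller carrier then changes neither
    the matrices nor the relations. The subspace W need not be stable under S;
    the presence of S is what rules out an E irreducible under F and K. *)
Definition reducible p q : Prop := forall n (E S : 'M[R]_n) (K F : seq 'M[R]_n),
  size K = p -> size F = q -> clifford_system K (S :: F) ->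
  all (fun x => stablemx E x) (S :: F ++ K) -> E != 0 ->
  exists W : 'M[R]_n, [/\ (W <= E)%MS, W != 0, (\rank W < \rank E)%N
    & all (fun x => stablemx W x) (F ++ K)].

(** Put w = abcd. It squares to 1, anticommutes with a, b, c, d and commutes with
    the other generators and with S, so aw, bw, cw, dw have square +1 and still
    anticommute with everything. The new system generates the same algebra,
    since (aw)(bw)(cw)(dw) = w and a = (aw)w, and so has the same stable
    subspaces. *)
Lemma reducible_swap p q : reducible p (4 + q) -> reducible (4 + p) q.
Proof.
move=> redpq n E S [|a [|b [|c [|d K]]]] // F [szK] szF.
rewrite /clifford_system /= all_cat pairwise_cat /= !allrel_consr.
case/and3P => /and5P[/eqP a2 /eqP b2 /eqP c2 /eqP d2 K2] /andP[S2 F2].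
case/andP => /andP[SF /and5P[Sa Sb Sc Sd SK]] /andP[/and5P[Fa Fb Fc Fd FK]].
case/and5P => pF /and4P[ab ac ad aK] /and3P[bc bd bK] /andP[cd cK] /andP[dK pK].
rewrite all_cat /= => /andP[ES /andP[EF /and5P[Ea Eb Ec Ed EK]]] E0.
pose w := (a * b) * (c * d).
have w2 : w * w = 1.
  rewrite sqrM_comm ?sqrM_anti // ?a2 ?b2 ?c2 ?d2 ?mulrNN ?mulr1 ?mulrNN ?mulr1 //.
  by apply: (@sgncommMl _ false false); apply: (@sgncommM _ true true).
have comw x : anti x a -> anti x b -> anti x c -> anti x d -> sgncomm false x w.
  exact: (@sgncommM4 _ true true true true).
have aw : anti a w.
  by apply: (@sgncommM4 _ false true true true) => //; apply: sgncommxx.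
have bw : anti b w.
  apply: (@sgncommM4 _ true false true true) => //; last exact: sgncommxx.
  exact: anti_sym ab.
have cw : anti c w.
  apply: (@sgncommM4 _ true true false true); rewrite ?sgncommxx //.
    exact: anti_sym ac.
  exact: anti_sym bc.
have dw : anti d w.
  apply: (@sgncommM4 _ true true true false); rewrite ?sgncommxx //.
  - exact: anti_sym ad.
  - exact: anti_sym bd.
  - exact: anti_sym cd.
have Sw : sgncomm false S w by apply: comw.
have Fw y : y \in F -> sgncomm false y w.
  move=> yF; apply: comw.
  - exact: (allP Fa).
  - exact: (allP Fb).
  - exact: (allP Fc).
  - exact: (allP Fd).
have Kw y : y \in K -> sgncomm false y w.
  move=> yK; apply: comw; apply: anti_sym.
  - exact: (allP aK).
  - exact: (allP bK).
  - exact: (allP cK).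
  - exact: (allP dK).
have sqrw x : x * x = -1 -> anti x w -> (x * w) * (x * w) == 1.
  by move=> x2 xw; rewrite sqrM_anti // x2 w2 mulr1 opprK.
have antiww x y : anti x y -> anti x w -> anti y w -> anti (x * w) (y * w).
  move=> xy xw yw; apply: (@sgncommMl _ false true).
    exact: (@sgncommM _ true true).
  by apply: (@sgncommM _ true false); [apply: anti_sym|apply: sgncommxx].
have antiwl x y : anti x y -> sgncomm false y w -> anti (x * w) y.
  by move=> xy yw; apply: (@sgncommMl _ true false) => //; rewrite sgncomm_sym.
have antiwK x : all (anti x) K -> all (anti (x * w)) K.
  by move=> /allP xK; apply/allP => y yK; apply: antiwl; [exact: xK|exact: Kw].
have antiwF x : all (anti^~ x) F -> all (anti (x * w)) F.
  by move=> /allP xF; apply/allP => y yF; apply/antiwl/Fw => //; apply/anti_sym/xF.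
have antiSw x : anti S x -> anti S (x * w).
  by move=> Sx; apply: (@sgncommM _ true false).
have [] := redpq n E S K [:: a * w, b * w, c * w, d * w & F] => //.
- by rewrite /= szF.
- rewrite /clifford_system /= K2 S2 F2 (sqrw a) // (sqrw b) // (sqrw c) //.
  rewrite (sqrw d) // all_cat SF SK pairwise_cat FK pF pK.
  by rewrite !all_cat (antiSw _ Sa) (antiSw _ Sb) (antiSw _ Sc) (antiSw _ Sd)
    (antiww _ _ ab aw bw) (antiww _ _ ac aw cw) (antiww _ _ ad aw dw)
    (antiww _ _ bc bw cw) (antiww _ _ bd bw dw) (antiww _ _ cd cw dw)
    (antiwF _ Fa) (antiwF _ Fb) (antiwF _ Fc) (antiwF _ Fd)
    (antiwK _ aK) (antiwK _ bK) (antiwK _ cK) (antiwK _ dK).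
- have Ew := stablemx_mul (stablemx_mul Ea Eb) (stablemx_mul Ec Ed).
  rewrite /= ES all_cat EF EK !andbT.
  by rewrite (stablemx_mul Ea Ew) (stablemx_mul Eb Ew) (stablemx_mul Ec Ew)
    (stablemx_mul Ed Ew).
move=> W [WE W0 rW]; rewrite all_cat /= => /andP[/and5P[Wa Wb Wc Wd WF] WK].
exists W; split=> //.
have Ww : stablemx W w.
  have -> : w = (a * w) * (b * w) * ((c * w) * (d * w)).
    have ww x y : anti x w -> anti y w -> x * w * (y * w) = - (x * y).
      move=> xw /antiE yw.
      by rewrite -mulrA (mulrA w) -[w * y]opprK -yw mulNr mulrN -(mulrA y) w2 mulr1.
    by rewrite (ww a b) // (ww c d) // mulrNN.
  exact (stablemx_mul (stablemx_mul Wa Wb) (stablemx_mul Wc Wd)).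
have Wx x : stablemx W (x * w) -> stablemx W x.
  move=> Wxw; have -> : x = x * w * w by rewrite -mulrA w2 mulr1.
  exact: stablemx_mul Wxw Ww.
by rewrite all_cat /= WF WK (Wx a) ?(Wx b) ?(Wx c) ?(Wx d).
Qed.

(** The involution h = ef commutes with S and with all generators but e and f, so
    the hypothesis applies to its fixed space in E. A stable subspace W there
    induces W + We, stable under e, under h, and hence under f = - eh. *)
Lemma reducible_drop p q : reducible p q -> reducible p.+1 q.+1.
Proof.
move=> redpq n E S [|e K] // [|f F] // [szK] [szF].
rewrite /clifford_system /= all_cat pairwise_cat /= !allrel_consr.
case/and3P => /andP[/eqP e2 K2] /and3P[S2 /eqP f2 F2].
case/andP => /andP[Sf]; rewrite !all_cat /= => /and3P[SF Se SK].
case/andP => /and3P[fF fe fK] /andP[/andP[Fe FK] /and3P[pF eK pK]].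
case/and4P => ES Ef EF /andP[Ee EK] E0.
have ef := anti_sym fe.
pose h := e * f.
have h2 : h * h = 1 by rewrite sqrM_anti // e2 f2 mulr1 opprK.
have eh : anti e h by apply: (@sgncommM _ false true) => //; apply: sgncommxx.
have e2' : e * e = (-1) ^+ true by rewrite e2.
have Eh : stablemx E h := stablemx_mul Ee Ef.
have P0 := pos_part_neq0 h2 e2' eh Eh Ee E0.
have comh x : anti x e -> anti x f -> sgncomm false x h.
  by move=> xe xf; apply: (@sgncommM _ true true).
have PS : stablemx (pos_part E h) S := pos_part_stable (comh _ Se Sf) ES.
have PF : all (fun x => stablemx (pos_part E h) x) F.
  apply/allP => x xF; apply: pos_part_stable (allP EF _ xF).
  by apply: comh; [exact: (allP Fe)|apply/anti_sym/(allP fF)].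
have PK : all (fun x => stablemx (pos_part E h) x) K.
  apply/allP => x xK; apply: pos_part_stable (allP EK _ xK).
  by apply: comh; apply: anti_sym; [exact: (allP eK)|exact: (allP fK)].
have [] := redpq n (pos_part E h) S K F szK szF _ _ P0.
- by rewrite /clifford_system /= K2 S2 F2 all_cat SF SK pairwise_cat FK pF.
- by rewrite /= PS all_cat PF PK.
move=> W [WP W0 rW]; rewrite all_cat => /andP[WF WK].
exists (W + W *m e)%MS; split.
- exact: (lift_sub Ee WP).
- exact: (lift_neq0 e2' eh WP W0).
- exact: (lift_rank e2' eh Ee WP rW).
have We := lift_stable_g e2' W.
have Wf : stablemx (W + W *m e)%MS f.
  have -> : f = - (e * h) by rewrite mulrA e2 mulN1r opprK.
  by rewrite stablemxN; exact: stablemx_mul We (lift_stable_h eh WP).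
rewrite all_cat /= We Wf /=; apply/andP; split; apply/allP => x xs.
  by apply: lift_stable (allP Fe _ xs) (allP WF _ xs).
by apply: lift_stable (allP WK _ xs); apply/anti_sym/(allP eK).
Qed.

(** The fixed space of the generator is proper because S moves it to the
    eigenspace for -1. *)
Lemma reducible01 : reducible 0 1.
Proof.
move=> n E S [|] // [|f []] // _ _; rewrite /clifford_system /= !andbT.
case/andP => /andP[/eqP S2 /eqP f2] Sf /andP[ES Ef] E0.
have S2' : S * S = (-1) ^+ false by rewrite S2.
exists (pos_part E f); split; first exact: capmxSl.
- exact: (pos_part_neq0 f2 S2' Sf Ef ES E0).
- exact: (pos_part_rank_lt f2 S2' Sf Ef ES E0).
by rewrite pos_part_stable // sgncommxx.
Qed.

(** The product abc is central of square 1 in the algebra of a, b, c, and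
    anticommutes with S, so its fixed space is a proper submodule. *)
Lemma reducible30 : reducible 3 0.
Proof.
move=> n E S [|a [|b [|c []]]] // [] // _ _; rewrite /clifford_system /= !andbT.
case/and3P => /and3P[/eqP a2 /eqP b2 /eqP c2] /eqP S2.
case/andP => /and3P[Sa Sb Sc] /andP[/andP[ab ac] bc] /and4P[ES Ea Eb Ec] E0.
pose h := a * b * c.
have h2 : h * h = 1.
  rewrite sqrM_comm; last by apply: (@sgncommMl _ true true).
  by rewrite sqrM_anti // a2 b2 c2 mulrNN mulr1 mulrNN mulr1.
have S2' : S * S = (-1) ^+ false by rewrite S2.
have Sh : anti S h.
  by apply: (@sgncommM _ false true) => //; apply: (@sgncommM _ true true).
have Eh : stablemx E h := stablemx_mul (stablemx_mul Ea Eb) Ec.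
have ah : sgncomm false a h.
  apply: (@sgncommM _ true true) => //.
  by apply: (@sgncommM _ false true) => //; apply: sgncommxx.
have bh : sgncomm false b h.
  apply: (@sgncommM _ true true) => //.
  by apply: (@sgncommM _ true false); [apply: anti_sym|apply: sgncommxx].
have ch : sgncomm false c h.
  apply: (@sgncommM _ false false); last exact: sgncommxx.
  by apply: (@sgncommM _ true true); apply: anti_sym.
have P0 := pos_part_neq0 h2 S2' Sh Eh ES E0.
exists (pos_part E h); split; first exact: capmxSl.
- exact: P0.
- exact: (pos_part_rank_lt h2 S2' Sh Eh ES E0).
by rewrite (pos_part_stable ah) // (pos_part_stable bh) // (pos_part_stable ch).
Qed.

Lemma no_real_eigenvector n (j : 'M[R]_n) (v : 'rV_n) (c l : R) :
  j * j = - c%:M -> 0 < c -> v *m j = l *: v -> v = 0.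
Proof.
move=> j2 c0 vj; apply/eqP.
have : v *m (j *m j) = - c *: v by rewrite [j *m j]j2 mulmxN mul_mx_scalar scaleNr.
rewrite mulmxA vj -scalemxAl vj scalerA => /eqP; rewrite -subr_eq0 -scalerBl.
by rewrite scaler_eq0 opprK gt_eqF //= ltr_wpDl // -expr2 sqr_ge0.
Qed.

(** On the fixed space P of f the product gS acts as a complex structure, so P is
    not a line: for a nonzero v in P the span of v and vg is a proper submodule. *)
Lemma reducible02 : reducible 0 2.
Proof.
move=> n E S [|] // [|f [|g []]] // _ _; rewrite /clifford_system /= !andbT.
case/andP => /and3P[/eqP S2 /eqP f2 /eqP g2] /andP[/andP[Sf Sg] fg].
case/and3P => ES Ef Eg E0.
have gf : anti g f by rewrite sgncomm_sym.
have g2' : g * g = (-1) ^+ false by rewrite g2.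
have P0 := pos_part_neq0 f2 g2' gf Ef Eg E0.
pose j := g * S; pose v := nz_row (pos_part E f).
have v0 : v != 0 by rewrite nz_row_eq0.
have vP : (v <= pos_part E f)%MS by apply: nz_row_sub.
have jf : sgncomm false j f by apply: (@sgncommMl _ true true).
have j2 : j * j = - 1%:M.
  by rewrite sqrM_anti ?g2 ?S2 ?mul1r // sgncomm_sym.
have Pj : stablemx (pos_part E f) j := pos_part_stable jf (stablemx_mul Eg ES).
exists (v + v *m g)%MS; split.
- exact: (lift_sub Eg vP).
- exact: (lift_neq0 g2' gf vP v0).
- apply: (lift_rank g2' gf Eg vP).
  rewrite (ltn_leqif (mxrank_leqif_sup vP)); apply: contra v0 => Pv.
  have /sub_rVP[l vj] : (v *m j <= v)%MS.
    by apply: submx_trans Pv; apply: submx_trans Pj; apply: submxMr.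
  by apply/eqP; apply: (no_real_eigenvector j2 ltr01 vj).
by rewrite (lift_stable_h gf vP) (lift_stable_g g2').
Qed.

(** On the fixed space P of f the products i = gk and j = gS are anticommuting
    complex structures, so P is at least 4-dimensional: for a nonzero v in P
    the plane F spanned by v and vi is proper in P, and F + Fg is a submodule. *)
Lemma reducible03 : reducible 0 3.
Proof.
move=> n E S [|] // [|f [|g [|k []]]] // _ _; rewrite /clifford_system /= !andbT.
case/andP => /and4P[/eqP S2 /eqP f2 /eqP g2 /eqP k2].
case/andP => /and3P[Sf Sg Sk] /andP[/andP[fg fk] gk].
case/and4P => ES Ef Eg Ek E0.
have gf := anti_sym fg; have kf := anti_sym fk; have gS := anti_sym Sg.
have g2' : g * g = (-1) ^+ false by rewrite g2.
have P0 := pos_part_neq0 f2 g2' gf Ef Eg E0.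
pose i := g * k; pose j := g * S; pose v := nz_row (pos_part E f).
have v0 : v != 0 by rewrite nz_row_eq0.
have vP : (v <= pos_part E f)%MS by apply: nz_row_sub.
have i_f : sgncomm false i f by apply: (@sgncommMl _ true true).
have jf : sgncomm false j f by apply: (@sgncommMl _ true true).
have i2 : i * i = - 1 by rewrite sqrM_anti // g2 k2 mul1r.
have j2 : j * j = - 1 by rewrite sqrM_anti // g2 S2 mul1r.
have gi : anti g i by apply: (@sgncommM _ false true) => //; apply: sgncommxx.
have ij : anti i j.
  apply: (@sgncommMl _ true false).
    by apply: (@sgncommM _ false true) => //; apply: sgncommxx.
  by apply: (@sgncommM _ true true) => //; apply: anti_sym.
have Pi : stablemx (pos_part E f) i := pos_part_stable i_f (stablemx_mul Eg Ek).
have Pj : stablemx (pos_part E f) j := pos_part_stable jf (stablemx_mul Eg ES).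
pose F := (v + v *m i)%MS.
have FP : (F <= pos_part E f)%MS.
  by rewrite addsmx_sub vP (submx_trans (submxMr _ vP)).
have Fi : stablemx F i.
  rewrite addsmxMr -mulmxA [i *m i]i2 mulmxN mulmx1 addsmxC addsmxS //.
  by rewrite eqmx_opp.
have F0 : F != 0.
  by rewrite -submx0; apply: contra v0 => /(submx_trans (addsmxSl _ _)); rewrite submx0.
exists (F + F *m g)%MS; split.
- exact: (lift_sub Eg FP).
- exact: (lift_neq0 g2' gf FP F0).
- apply: (lift_rank g2' gf Eg FP).
  rewrite (ltn_leqif (mxrank_leqif_sup FP)); apply: contra v0 => PF.
  have /sub_addsmxP[[x y] /= vj] : (v *m j <= v + v *m i)%MS.
    by apply: submx_trans PF; apply: submx_trans Pj; apply: submxMr.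
  (* If F were all of P, then vj = xv + y(vi) for scalars x and y. So v would be
     a real eigenvector of j - yi, whose square is -(1 + y^2). *)
  pose j' := j - y 0 0 *: i.
  have j'2 : j' * j' = - (1 + y 0 0 ^+ 2)%:M.
    rewrite [LHS]mulmxBl !mulmxBr -!scalemxAl -!scalemxAr.
    rewrite [i *m j](antiE ij) [j *m j]j2 [i *m i]i2 !scalerN.
    rewrite opprB opprK addrACA addNr addr0 scalerA -expr2 -opprD scalemx1.
    by congr (- _); rewrite [RHS](raddfD (@scalar_mx R n)).
  have vj' : v *m j' = x 0 0 *: v.
    rewrite mulmxBr vj -scalemxAr {1}[x]mx11_scalar {1}[y]mx11_scalar.
    by rewrite !mul_scalar_mx addrK.
  by apply/eqP; apply: no_real_eigenvector j'2 _ vj'; rewrite ltr_wpDr ?sqr_ge0.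
have Wg := lift_stable_g g2' F.
have -> : k = g * i by rewrite mulrA g2 mul1r.
have Wi : stablemx (F + F *m g)%MS i := lift_stable (anti_sym gi) Fi.
by rewrite (lift_stable_h gf FP) Wg (stablemx_mul Wg Wi).
Qed.

Lemma reducible_add8 p q : reducible p q -> reducible (8 + p) q.
Proof. by move=> H; apply: (@reducible_swap (4 + p)); do 4 apply: reducible_drop. Qed.

Lemma reducible_mod8 r t : r \in [:: 3; 5; 6; 7]%N -> reducible (r + 8 * t) 0.
Proof.
move=> r_in; elim: t => [|t IHt]; last first.
  by rewrite mulnS addnCA; apply: reducible_add8.
rewrite muln0 addn0; move: r_in; rewrite !inE => /or4P[] /eqP->.
- exact: reducible30.
- by apply: (@reducible_swap 1); apply: reducible_drop; apply: reducible03.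
- by apply: (@reducible_swap 2); do 2 apply: reducible_drop; apply: reducible02.
- by apply: (@reducible_swap 3); do 3 apply: reducible_drop; apply: reducible01.
Qed.

End CliffordSystems.

(** * Invariant forms and real eigenvalues *)

Section InvariantForms.
Variables (R : realFieldType) (n : nat).
Implicit Types (A B T : 'M[R]_n) (v : 'rV[R]_n).

Definition posdefmx B := forall v, v != 0 -> 0 < (v *m B *m v^T) 0 0.

Lemma posdefmx_unit B : posdefmx B -> B \in unitmx.
Proof.
move=> Bpos; rewrite -row_free_unit -kermx_eq0 -nz_row_eq0.
apply/negPn/negP => /Bpos; have /sub_kermxP -> := nz_row_sub (kermx B).
by rewrite mul0mx mxE ltxx.
Qed.

(** Averaging one generator at a time: if B is invariant under the generators
    after A, then so is B + A B A^T, as A commutes with them up to a sign, which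
    disappears in C B C^T; and it is invariant under A since A^2 = 1 or -1. *)
Lemma invariant_posdefmx (s : seq 'M[R]_n) :
    pairwise anti s -> all (fun A => (A * A == 1) || (A * A == -1)) s ->
  exists B, [/\ B^T = B, posdefmx B & {in s, forall A, A *m B *m A^T = B}].
Proof.
elim: s => [_ _|A s IHs /= /andP[As sp] /andP[A2 s2]].
  exists 1%:M; split=> // [|v v0]; first exact: trmx1.
  rewrite mulmx1 mxE.
  have ge0 i : 0 <= v 0 i * v^T i 0 by rewrite mxE -expr2 sqr_ge0.
  rewrite lt0r sumr_ge0 // andbT; apply: contra v0 => /eqP/psumr_eq0P v0.
  apply/eqP/rowP => i; apply/eqP; rewrite mxE -sqrf_eq0 expr2.
  by have := v0 (fun i _ => ge0 i) i isT; rewrite mxE => ->.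
have [B [Bsym Bpos Binv]] := IHs sp s2.
have AAB : A *m (A *m B *m A^T) *m A^T = B.
  have -> : A *m (A *m B *m A^T) *m A^T = (A *m A) *m B *m (A *m A)^T.
    by rewrite trmx_mul !mulmxA.
  have /orP[/eqP->|/eqP->] : (A *m A == 1%:M) || (A *m A == - 1%:M) by exact: A2.
    by rewrite trmx1 mulmx1 mul1mx.
  by rewrite linearN /= trmx1 mulmxN mulNmx mulmx1 mul1mx opprK.
exists (B + A *m B *m A^T); split.
- by rewrite linearD /= !trmx_mul trmxK Bsym mulmxA.
- move=> v v0; rewrite mulmxDr mulmxDl mxE ltr_wpDr ?Bpos //.
  have -> : v *m (A *m B *m A^T) *m v^T = (v *m A) *m B *m (v *m A)^T.
    by rewrite trmx_mul !mulmxA.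
  have [->|/Bpos/ltW //] := eqVneq (v *m A) 0.
  by rewrite !mul0mx mxE.
move=> C; rewrite inE => /predU1P[->|Cs].
  by rewrite mulmxDr mulmxDl AAB addrC.
rewrite mulmxDr mulmxDl Binv //; congr (_ + _).
have CA : C *m A = - (A *m C) by apply: antiE; apply: anti_sym; apply: (allP As).
have -> : C *m (A *m B *m A^T) *m C^T = (C *m A) *m B *m (C *m A)^T.
  by rewrite trmx_mul !mulmxA.
rewrite CA linearN /= mulmxN !mulNmx opprK trmx_mul.
by rewrite -!mulmxA (mulmxA C) (mulmxA (C *m B)) Binv // !mulmxA.
Qed.

End InvariantForms.

(** A complex eigenvector x + iy for the eigenvalue a + ib gives
    b (B(x, x) + B(y, y)) = 0 by the symmetry of T, hence b = 0, and one of x, y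
    is a real eigenvector. *)
Lemma symmetric_eigenvalue (R : realType) n (B T : 'M[R]_n) :
    (0 < n)%N -> B^T = B -> posdefmx B -> T *m B = B *m T^T ->
  exists l : R, eigenvalue T l.
Proof.
move=> n0 Bsym Bpos TB.
have [[a b] /eigenvalueP[u uT u0]] :=
  spectral.eigenvalue_closed (map_mx (real_complex R) T) n0.
pose x := map_mx (@complex.Re R) u; pose y := map_mx (@complex.Im R) u.
have uE : u = map_mx (real_complex R) x + 'i%C *: map_mx (real_complex R) y.
  by apply/rowP => i; rewrite !mxE -complexE.
have [xT yT] : x *m T = a *: x + (- b) *: y /\ y *m T = b *: x + a *: y.
  move: uT; rewrite {1}uE mulmxDl -scalemxAl -!map_mxM.
  move: (x *m T) (y *m T) => p q /rowP uT.
  split; apply/rowP => i; move: (uT i); rewrite !mxE; case: (u 0 i) => c d.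
    by simpc => -[-> _]; rewrite ?mulNr.
  by simpc => -[_ ->]; rewrite addrC.
have xy0 : (x != 0) || (y != 0).
  rewrite -negb_and; apply: contra u0 => /andP[/eqP x0 /eqP y0].
  by rewrite uE x0 y0 !map_mx0 scaler0 addr0.
pose f (v w : 'rV[R]_n) : R := (v *m B *m w^T) 0 0.
have fl c d v w z : ((c *: v + d *: w) *m B *m z^T) 0 0 = c * f v z + d * f w z.
  by rewrite !mulmxDl -!scalemxAl mxE; congr (_ + _); rewrite mxE.
have fr c d v w z : (z *m B *m (c *: v + d *: w)^T) 0 0 = c * f z v + d * f z w.
  rewrite linearD !linearZ /= mulmxDr -!scalemxAr mxE.
  by congr (_ + _); rewrite mxE.
have f_ge0 v : 0 <= f v v.
  by have [->|/Bpos/ltW //] := eqVneq v 0; rewrite /f !mul0mx mxE.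
have b0 : b = 0.
  have : ((x *m T) *m B *m y^T) 0 0 = (x *m B *m (y *m T)^T) 0 0.
    by rewrite trmx_mul -!mulmxA (mulmxA T) TB !mulmxA.
  rewrite xT yT fl fr [RHS]addrC => /addrI/eqP; rewrite mulNr eq_sym -addr_eq0.
  rewrite -mulrDr mulf_eq0 => /orP[/eqP//|].
  by rewrite gt_eqF //; case/orP: xy0 => /Bpos lt0; [apply: ltr_wpDr|apply: ltr_wpDl].
exists a; case/orP: xy0 => z0; apply/eigenvalueP.
  by exists x => //; rewrite xT b0 oppr0 scale0r addr0.
by exists y => //; rewrite yT b0 scale0r add0r.
Qed.

(** * Restriction to a stable subspace *)

Section Restriction.
Variables (R : fieldType) (n : nat) (W : 'M[R]_n).
Implicit Types x y : 'M[R]_n.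

Lemma restrictmxM x y : stablemx W x -> stablemx W y ->
  restrictmx W (x * y) = restrictmx W x * restrictmx W y.
Proof. by move=> Wx Wy; rewrite conjmxM // inE stablemx_row_base. Qed.

Lemma restrictmxN x : restrictmx W (- x) = - restrictmx W x.
Proof. by rewrite /conjmx mulmxN mulNmx. Qed.

Lemma restrictmx1 : restrictmx W 1 = 1.
Proof. by rewrite [LHS]conjmx_scalar // row_base_free. Qed.

Lemma restrictmx_anti (s : seq 'M[R]_n) :
  all (fun x => stablemx W x) s -> pairwise anti s ->
  pairwise anti [seq restrictmx W x | x <- s].
Proof.
rewrite pairwise_map; apply: sub_in_pairwise => x y Wx Wy /= /antiE xy.
by rewrite /sgncomm mulN1r -!restrictmxM // xy restrictmxN.
Qed.

Lemma restrictmx_sqr (c : 'M[R]_n) (c' : 'M[R]_(\rank W)) (s : seq 'M[R]_n) :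
  restrictmx W c = c' ->
  all (fun x => stablemx W x) s -> all (fun x => x * x == c) s ->
  all (fun y : 'M_(\rank W) => y * y == c') [seq restrictmx W x | x <- s].
Proof.
move=> cc' /allP Ws /allP s2; rewrite all_map; apply/allP => x xs /=.
by rewrite -restrictmxM ?Ws // (eqP (s2 _ xs)) cc'.
Qed.

End Restriction.

(** * A small Clifford module from a skew form *)

Section HalfModule.
Variables (R : realType) (n : nat) (G : 'M[R]_n) (s : seq 'M[R]_n).
Hypotheses (n_gt0 : (0 < n)%N) (Gsym : G^T = G) (Gunit : G \in unitmx).
Hypotheses (s_anti : pairwise anti s) (s_sqr : all (fun x => x * x == 1) s).
Hypothesis s_skew : {in s, forall x, x *m G = - (G *m x^T)}.

(** With B as in [invariant_posdefmx], T = G B^-1 is symmetric for B. The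
    elements of s are skew for G and symmetric for B, so they anticommute
    with T. *)
Lemma skew_polarization : exists T : 'M[R]_n,
  [/\ T \in unitmx, all (anti T) s & exists l, eigenvalue T l].
Proof.
have [B [Bsym Bpos Binv]] : exists B : 'M[R]_n,
    [/\ B^T = B, posdefmx B & {in s, forall x, x *m B *m x^T = B}].
  apply: invariant_posdefmx s_anti _.
  by apply: sub_all s_sqr => x ->.
have Bu := posdefmx_unit Bpos.
exists (G *m invmx B); split.
- by rewrite unitmx_mul Gunit unitmx_inv.
- apply/allP => x xs; apply: anti_sym.
  rewrite /sgncomm mulN1r -!mulmxE mulmxA s_skew // mulNmx -!mulmxA.
  suff -> : x^T *m invmx B = invmx B *m x by [].
  apply: (can_inj (mulKmx Bu)); rewrite mulKVmx // mulmxA.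
  apply: (can_inj (mulmxK Bu)); rewrite mulmxKV //.
  have xx : x^T *m x^T = 1%:M.
    by rewrite -trmx_mul; have /eqP/(congr1 trmx) := allP s_sqr _ xs; rewrite trmx1.
  by rewrite -{1}(Binv _ xs) -(mulmxA (x *m B)) xx mulmx1.
apply: (symmetric_eigenvalue n_gt0 Bsym Bpos).
by rewrite mulmxKV // trmx_mul Gsym trmx_inv Bsym mulKVmx.
Qed.

(** On an eigenspace of T^2, where T acts as l times an involution S, the x S for
    x in s form a system of square -1, to which [reducible] applies. *)
Lemma half_module : reducible R (size s) 0 ->
  exists d (K : seq 'M[R]_d), [/\ (0 < d < n)%N, size K = size s,
    pairwise anti K & all (fun x => x * x == -1) K].
Proof.
move=> red; have [T [Tu sT [l Tl]]] := skew_polarization.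
have l0 : l != 0.
  have [v vT v0] := eigenvalueP Tl; apply: contra v0 => /eqP l0.
  by rewrite -(mulmxK Tu v) vT l0 scale0r mul0mx.
(* The eigenspace of T itself is not stable under s, which exchanges the
   eigenvalues l and - l; that of T^2 is. *)
pose U := eigenspace (T * T) (l * l).
have U0 : U != 0.
  have [v vT v0] := eigenvalueP Tl; apply: contra v0 => /eqP U0.
  rewrite -submx0 -U0; apply/eigenspaceP.
  by rewrite -mulmxE mulmxA vT -scalemxAl vT scalerA.
have UT : stablemx U T by apply: comm_mx_stable_eigenspace; rewrite /comm_mx !mulmxE mulrA.
have Us : all (fun x => stablemx U x) s.
  apply/allP => x xs; apply: comm_mx_stable_eigenspace.
  apply: commE; apply: (@sgncommMl _ true true); exact: (allP sT).
pose S := l^-1 *: restrictmx U T; pose s' := [seq restrictmx U x | x <- s].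
have S2 : S * S = 1.
  rewrite -mulmxE -scalemxAl -scalemxAr scalerA mulmxE -restrictmxM //.
  rewrite (@conjmx_eigenvalue _ _ _ (l * l)) ?row_base_free ?eq_row_base //.
  by rewrite scale_scalar_mx -invfM mulVf // mulf_neq0.
have s'_anti : pairwise anti s' by apply: restrictmx_anti.
have s'_sqr : all (fun x => x * x == 1) s' by apply: restrictmx_sqr (restrictmx1 _) _ _.
have Ss' : all (anti S) s'.
  rewrite all_map; apply/allP => x xs /=; rewrite /sgncomm mulN1r -!mulmxE.
  have Ux := allP Us _ xs.
  rewrite -scalemxAl -scalemxAr -scalerN !mulmxE -(restrictmxM UT Ux).
  by rewrite -(restrictmxM Ux UT) -restrictmxN -(antiE (allP sT _ xs)).
(* Multiplying by S changes the squares from 1 to -1. *)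
pose K := [seq x * S | x <- s'].
have K_sqr : all (fun x => x * x == -1) K.
  apply/allP => _ /mapP[x xs ->].
  rewrite (sqrM_anti (anti_sym (allP Ss' _ xs))).
  by rewrite S2 (eqP (allP s'_sqr _ xs)) mulr1.
have K_anti : pairwise anti K.
  rewrite pairwise_map; apply: sub_in_pairwise Ss' s'_anti => x y Sx Sy xy /=.
  apply: (@sgncommMl _ false true).
    by apply: (@sgncommM _ true true) => //; apply: anti_sym.
  by apply: (@sgncommM _ true false) => //; apply: sgncommxx.
have KS : all (anti S) K.
  apply/allP => _ /mapP[x xs ->].
  by apply: (@sgncommM _ true false); [exact: (allP Ss')|exact: sgncommxx].
have [] := red _ 1%:M S K [::] => //.
- by rewrite !size_map.
- by rewrite /clifford_system /= K_sqr S2 eqxx KS.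
- by rewrite /= !submx1; apply/allP => x _; apply: submx1.
- by rewrite -mxrank_eq0 mxrank1 mxrank_eq0.
move=> W [_ W0]; rewrite mxrank1 => rW WK.
exists (\rank W), [seq restrictmx W x | x <- K]; split.
- by rewrite lt0n mxrank_eq0 W0 (leq_trans rW) // rank_leq_row.
- by rewrite !size_map.
- exact: restrictmx_anti.
- by apply: restrictmx_sqr WK K_sqr; rewrite restrictmxN restrictmx1.
Qed.

End HalfModule.

(** * Generators of the Clifford algebra *)

Section Generators.
Variables (R : realType) (r s : nat).
Implicit Types (Z W : 'rV[R]_(r + s)) (i j : 'I_(r + s)).

Lemma rs_form_delta i j :
  rs_form (delta_mx 0 i) (delta_mx 0 j) = rs_sign r i * (i == j)%:R :> R.
Proof.
rewrite rs_formE (bigD1 i) //= big1 => [|l /negPf li]; rewrite !mxE ?li ?mul0r ?mulr0 //.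
by rewrite !eqxx mul1r addr0.
Qed.

Lemma rs_formD Z W : rs_form (Z + W) (Z + W) =
  rs_form Z Z + rs_form W W + (rs_form Z W + rs_form W Z).
Proof.
rewrite !rs_formE -!big_split; apply: eq_bigr => i _ /=.
by rewrite !mxE; ring.
Qed.

Lemma cl_gen_anticomm Z W : cl_gen Z * cl_gen W + cl_gen W * cl_gen Z =
  (- (rs_form Z W + rs_form W Z))%:A.
Proof.
have := cl_gen_sqrE (Z + W).
rewrite linearD /= mulrDl !mulrDr !cl_gen_sqrE => ZW.
apply: (addrI ((- rs_form Z Z)%:A + (- rs_form W W)%:A)).
rewrite addrACA [_%:A + _ * _ in X in _ + X]addrC ZW -!scalerDl.
by rewrite rs_formD !opprD.
Qed.

End Generators.

(** * Admissible modules and matrices *)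

Section FromModule.
Variables (R : realType) (k : nat) (N : admissible_module R 0 k).
Local Notation V := (am_space N).
Local Notation n := (dim V).
Local Notation vec := (@r2v R V).
Local Notation coords := (@v2r R V).

(** Matrices act on row vectors from the right, so this reverses products, which
    is harmless for the symmetric relations below. *)
Definition module_mx (i : 'I_(0 + k)) : 'M[R]_n :=
  lin1_mx (coords \o am_J N (delta_mx 0 i) \o vec).

Definition gram_mx : 'M[R]_n :=
  \matrix_(i, j) am_form N (vec (delta_mx 0 i)) (vec (delta_mx 0 j)).

Lemma mul_module_mx i u : u *m module_mx i = coords (am_J N (delta_mx 0 i) (vec u)).
Proof. by rewrite mul_rV_lin1. Qed.

Lemma gram_mxE u v : am_form N (vec u) (vec v) = (u *m gram_mx *m v^T) 0 0.
Proof.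
rewrite mxE {1}[v]row_sum_delta !linear_sum /=; apply: eq_bigr => j _.
rewrite !linearZ /= [v^T _ _]mxE mulrC; congr (_ * _).
rewrite mxE {1}[u]row_sum_delta linear_sum linear_sumlz /=; apply: eq_bigr => i _.
by rewrite linearZ linearZl_LR /= !mxE.
Qed.

Lemma am_J_anticomm i j v :
  am_J N (delta_mx 0 i) (am_J N (delta_mx 0 j) v)
  + am_J N (delta_mx 0 j) (am_J N (delta_mx 0 i) v) = (i == j)%:R *+ 2 *: v.
Proof.
rewrite /am_J -![am_rep N _ (am_rep N _ v)]comp_lfunE -!cl_repM -add_lfunE -linearD.
rewrite cl_gen_anticomm !rs_form_delta linearZ /= cl_rep1 scale_lfunE id_lfunE.
by rewrite /rs_sign ltn0 !mulN1r eq_sym -opprD opprK mulr2n.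
Qed.

Lemma module_mx_anticomm i j :
  module_mx i * module_mx j + module_mx j * module_mx i = ((i == j)%:R *+ 2)%:M.
Proof.
apply/row_matrixP => l; rewrite !rowE; move: (delta_mx 0 l) => u.
rewrite mulmxDr -!mulmxE !mulmxA !mul_module_mx !v2rK -linearD am_J_anticomm.
by rewrite linearZ /= r2vK mul_mx_scalar eq_sym.
Qed.

Lemma module_mx_anti i j : i != j -> anti (module_mx i) (module_mx j).
Proof.
move=> /negPf ij; have := module_mx_anticomm i j.
by rewrite ij mul0rn raddf0 /sgncomm mulN1r => /eqP; rewrite addr_eq0.
Qed.

Lemma module_mx_sqr i : module_mx i * module_mx i == 1.
Proof.
have := module_mx_anticomm i i; rewrite eqxx.
rewrite -mulr2n raddfMn /= => /eqP.
rewrite -subr_eq0 -mulrnBl -scaler_nat scaler_eq0 pnatr_eq0 /=.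
by rewrite subr_eq0.
Qed.

Lemma gram_mx_sym : gram_mx^T = gram_mx.
Proof. by apply/matrixP => i j; rewrite !mxE am_formC. Qed.

Lemma gram_mx_unit : gram_mx \in unitmx.
Proof.
rewrite -row_free_unit -kermx_eq0 -nz_row_eq0; set u := nz_row _.
have uG : u *m gram_mx = 0 by apply/sub_kermxP/nz_row_sub.
suff : vec u == 0 by rewrite -(inj_eq (can_inj r2vK)) linear0.
rewrite -memv0 -(eqP (am_nondegenerate N)); apply/mem_orthovP => w _.
by rewrite -[w]v2rK gram_mxE uG mul0mx mxE.
Qed.

Lemma module_mx_skew i : module_mx i *m gram_mx = - (gram_mx *m (module_mx i)^T).
Proof.
suff H (u v : 'rV[R]_n) : (u *m (module_mx i *m gram_mx) *m v^T) 0 0 =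
    (u *m (- (gram_mx *m (module_mx i)^T)) *m v^T) 0 0.
  apply/matrixP => a b; have := H (delta_mx 0 a) (delta_mx 0 b).
  by rewrite -!rowE !trmx_delta -!colE !mxE.
have -> : u *m (- (gram_mx *m (module_mx i)^T)) *m v^T =
    - (u *m gram_mx *m (v *m module_mx i)^T).
  by rewrite trmx_mul mulmxN mulNmx !mulmxA.
by rewrite mulmxA [RHS]mxE -!gram_mxE !mul_module_mx !v2rK am_J_skew.
Qed.

End FromModule.

Section ToModule.
Variables (R : realType) (k d : nat) (K : 'I_(k + 0) -> 'M[R]_d.+1).
Hypothesis K_anti : forall i j, i != j -> anti (K i) (K j).
Hypothesis K_sqr : forall i, K i * K i = -1.

Definition gen_mx (Z : 'rV[R]_(k + 0)) : 'M[R]_d.+1 := \sum_i Z 0 i *: K i.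

Fact gen_mx_linear : linear gen_mx.
Proof.
move=> a Z W; rewrite /gen_mx scaler_sumr -big_split; apply: eq_bigr => i _ /=.
by rewrite !mxE scalerDl scalerA.
Qed.
HB.instance Definition _ := GRing.isLinear.Build R _ _ _ gen_mx gen_mx_linear.

(** The square, written as a double sum and added to its transpose, involves
    only the anticommutators of the K i. *)
Lemma gen_mx_sqr Z : gen_mx Z * gen_mx Z = (- rs_form Z Z)%:A.
Proof.
have E2 : gen_mx Z * gen_mx Z = \sum_i \sum_j (Z 0 i * Z 0 j) *: (K i * K j).
  rewrite mulr_suml; apply: eq_bigr => i _; rewrite mulr_sumr.
  by apply: eq_bigr => j _; rewrite -scalerAl -scalerAr scalerA.
have KK i j : K i * K j + K j * K i = (- ((i == j)%:R *+ 2) : R)%:A.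
  have [<-|ij] := eqVneq i j; first by rewrite K_sqr scaleNr scaler_nat mulr2n opprD.
  by rewrite (antiE (K_anti ij)) addNr mul0rn oppr0 scale0r.
apply: (@scalerI R _ 2); first by rewrite pnatr_eq0.
rewrite scaler_nat mulr2n E2 {1}exchange_big /= -big_split /=.
rewrite rs_formE -sumrN scaler_suml scaler_sumr; apply: eq_bigr => i _.
rewrite -big_split (bigD1 i) //= big1 => [|j /negPf ji].
  rewrite addr0 -scalerDr KK eqxx !scalerA; congr (_ *: _).
  rewrite /rs_sign; have -> : (i < k)%N by rewrite -[X in (_ < X)%N]addn0.
  by rewrite mul1r -[true%:R]/(1 : R); ring.
by rewrite [Z 0 j * _]mulrC -scalerDr KK ji mul0rn oppr0 scale0r scaler0.
Qed.

(** Every family of anticommuting matrices of square -1 gives an admissible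
    module: it extends to the Clifford algebra by the universal property, and an
    averaged positive definite form is admissible because an orthogonal operator
    of square -1 is skew. The matrices are transposed to make the right action on
    row vectors a representation. *)
Lemma admissible_of_gen_mx :
  exists M : admissible_module R k 0, \dim {: am_space M} = d.+1.
Proof.
have [f fgen _] := clifford_universal gen_mx_sqr.
pose s := [seq (K i)^T | i <- enum 'I_(k + 0)].
have s_anti : pairwise anti s.
  rewrite pairwise_map.
  have := enum_uniq 'I_(k + 0); rewrite uniq_pairwise; apply: sub_pairwise.
  move=> i j /K_anti /antiE ij /=.
  by rewrite /sgncomm mulN1r -!mulmxE -!trmx_mul !mulmxE ij linearN /= opprK.
have [B [Bsym Bpos Binv]] : exists B : 'M[R]_d.+1,
    [/\ B^T = B, posdefmx B & {in s, forall A, A *m B *m A^T = B}].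
  apply: invariant_posdefmx => //; apply/allP => _ /mapP[i _ ->].
  by rewrite -!mulmxE -trmx_mul mulmxE K_sqr linearN /= trmx1 eqxx orbT.
have KB i : (K i)^T *m B = - (B *m K i).
  have {2}<- := Binv (K i)^T (map_f _ (mem_enum _ i)).
  by rewrite trmxK -!mulmxA [K i *m K i](K_sqr i) !mulmxN mulmx1 opprK.
have genB Z : (gen_mx Z)^T *m B = - (B *m gen_mx Z).
  rewrite linear_sum mulmx_suml mulmx_sumr -sumrN; apply: eq_bigr => i _.
  by rewrite linearZ /= -scalemxAl -scalemxAr KB scalerN.
pose act x : 'End('rV[R]_d.+1) := linfun (mulmxr (f x)^T).
have actE x v : act x v = v *m (f x)^T by rewrite lfunE.
have act_linear : linear act.
  move=> a x y; apply/lfunP => v; rewrite add_lfunE scale_lfunE !actE.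
  by rewrite linearP linearP /= mulmxDr -scalemxAr.
pose actL : {linear clifford R k 0 -> 'End('rV[R]_d.+1)} :=
  HB.pack act (GRing.isLinear.Build R _ _ _ act act_linear).
have act1 : actL 1 = \1%VF.
  by apply/lfunP => v; rewrite /= actE rmorph1 id_lfunE trmx1 mulmx1.
have actM x y : actL (x * y) = (actL x \o actL y)%VF.
  by apply/lfunP => v; rewrite comp_lfunE /= !actE rmorphM trmx_mul mulmxA.
pose rep := CliffordRep act1 actM.
have B_herm : B \is symmetricmx.
  by apply/is_hermitianmxP; rewrite expr0 scale1r map_mx_id.
pose form : {symmetric 'rV[R]_d.+1} := form_of_matrix idfun (HermitianMx B_herm).
have formE v w : form v w = (v *m B *m w^T) 0 0.
  by rewrite /form /= /form_of_matrix map_mx_id // trace_mx11.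
have dimE : \dim {: 'rV[R]_d.+1} = d.+1 by rewrite dimvf; apply: mul1n.
have dim_gt0 : (0 < \dim {: 'rV[R]_d.+1})%N by rewrite dimE.
have form_nondeg : nondegenerate form.
  rewrite /nondegenerate -subv0; apply/subvP => v /mem_orthovP vv; rewrite memv0.
  apply/negPn/negP => /Bpos; rewrite -formE vv ?memvf //.
  by rewrite ltxx.
have form_skew Z v w : form (rep (cl_gen Z) v) w = - form v (rep (cl_gen Z) w).
  rewrite !formE /= !actE fgen trmx_mul trmxK.
  rewrite -(mulmxA v) [(gen_mx Z)^T *m B]genB mulmxN mulNmx mxE.
  by rewrite !mulmxA.
by exists (AdmissibleModule dim_gt0 form_nondeg form_skew).
Qed.

End ToModule.

(** * Dimensions *)

Lemma lie_isomorphic_dim (R : realType) (r s r' s' : nat)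
    (M : admissible_module R r s) (N : admissible_module R r' s') :
  (r + s = r' + s')%N -> lie_isomorphic (pseudo_H M) (pseudo_H N) ->
  \dim {: am_space M} = \dim {: am_space N}.
Proof.
move=> rs [f [g fK gK] _].
have kerf : lker (linfun f) == 0%VS.
  by apply/lker0P => x y; rewrite !lfunE /= => /(can_inj fK).
have imf : limg (linfun f) = fullv.
  apply/vspaceP => y; rewrite memvf; apply/memv_imgP.
  by exists (g y); rewrite ?memvf // lfunE /= gK.
have dimf : \dim {: pseudo_H N} = \dim {: pseudo_H M}.
  by rewrite -imf; apply: limg_dim_eq; rewrite (eqP kerf) capv0.
move: dimf; rewrite !dimvf => dimf.
have {}dimf : (dim (am_space N) + 1 * (r' + s') = dim (am_space M) + 1 * (r + s))%N.
  exact: dimf.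
by move: dimf; rewrite rs => /addIn.
Qed.

Lemma smaller_admissible_module (R : realType) (k : nat)
    (N : admissible_module R 0 k) : reducible R k 0 ->
  exists M : admissible_module R k 0,
    (\dim {: am_space M} < \dim {: am_space N})%N.
Proof.
move=> red.
pose s := [seq module_mx N i | i <- enum 'I_(0 + k)].
have s_anti : pairwise anti s.
  rewrite pairwise_map.
  have := enum_uniq 'I_(0 + k); rewrite uniq_pairwise; apply: sub_pairwise => i j.
  exact: module_mx_anti.
have s_sqr : all (fun x => x * x == 1) s.
  by apply/allP => _ /mapP[i _ ->]; apply: module_mx_sqr.
have s_skew : {in s, forall x, x *m gram_mx N = - (gram_mx N *m x^T)}.
  by move=> _ /mapP[i _ ->]; apply: module_mx_skew.
have size_s : size s = k by rewrite size_map size_enum_ord.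
have N_gt0 : (0 < dim (am_space N))%N by rewrite -dimvf am_neq0.
have [] := half_module N_gt0 (gram_mx_sym N) (gram_mx_unit N) s_anti s_sqr s_skew.
  by rewrite size_s.
move=> [|d] [K [/andP[// _ dN]]]; rewrite size_s => size_K K_anti K_sqr.
have KP : {in gtn (size K) &, {homo nth 0 K : i j / (i < j)%N >-> anti i j}}.
  exact/pairwiseP.
have lt_K (i : 'I_(k + 0)) : (i < size K)%N by rewrite size_K -[X in (_ < X)%N]addn0.
have [i j ij|i|M dimM] := admissible_of_gen_mx (K := fun i : 'I_(k + 0) => K`_i).
- move: ij; rewrite -val_eqE neq_ltn => /orP[] lt_ij.
    by apply: KP; rewrite // inE lt_K.
  by apply/anti_sym/KP; rewrite // inE lt_K.
- by apply/eqP/(allP K_sqr)/mem_nth.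
by exists M; rewrite dimM [X in (_ < X)%N]dimvf.
Qed.

Local Close Scope ring_scope.

Theorem theorem4p12 (R : realType) (r t : nat)
    (hr : r \in [:: 3; 5; 6; 7])
    (M : admissible_module R (r + 8 * t) 0)
    (N : admissible_module R 0 (r + 8 * t))
    (hM : minimal_admissible M) (hMpos : positive_definite_module M)
    (hN : minimal_admissible N) :
  ~ lie_isomorphic (pseudo_H M) (pseudo_H N).
Proof.
move=> /lie_isomorphic_dim dimMN.
have [M' lt_M'N] := smaller_admissible_module N (@reducible_mod8 R r t hr).
by have := leq_ltn_trans (hM M') lt_M'N; rewrite dimMN ?ltnn // addn0.
Qed.
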